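(* Let $\mathbb{F}_q$ be a finite field with $q$ elements of odd characteristic, and let $\Gamma^2=\{\boldsymbol{\xi}\in\mathbb{F}_q^3:\xi_1^2=\xi_2\xi_3\}\setminus\{\boldsymbol{0}\}$, equipped with its normalized counting measure $\sigma$. Then for every function $f:\Gamma^2\to\mathbb{C}$, $$\|(f\sigma)^{\vee}\|^4_{L^4(\mathbb{F}_q^3,d\boldsymbol{x})}\leq \frac{q^3}{|\Gamma^2|^2}\left(q+1-\frac{3q-4}{|\Gamma^2|}\right)\|f\|^4_{L^2(\Gamma^2,d\sigma)}.$$ This inequality is sharp (the constant on the right-hand side cannot be replaced by a smaller one), and equality holds if $f$ is a constant function. Moreover, any maximizer $f$ of this inequality has constant modulus, i.e. $|f|$ is constant on $\Gamma^2$.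
   Context: Fix a non-principal (nontrivial) additive character $\chi:\mathbb{F}_q\to\{z\in\mathbb{C}:|z|=1\}$. For a nonempty finite set $\mathcal{S}\subset\mathbb{F}_q^3$ and $f:\mathcal{S}\to\mathbb{C}$, define for $\boldsymbol{x}\in\mathbb{F}_q^3$ $$(f\sigma)^\vee(\boldsymbol{x})=\frac{1}{|\mathcal{S}|}\sum_{\boldsymbol{\xi}\in\mathcal{S}}f(\boldsymbol{\xi})\chi(\boldsymbol{\xi}\cdot\boldsymbol{x}),\qquad \boldsymbol{\xi}\cdot\boldsymbol{x}=\xi_1x_1+\xi_2x_2+\xi_3x_3.$$ Norms: $d\boldsymbol{x}$ is counting measure, so $\|g\|_{L^4(\mathbb{F}_q^3,d\boldsymbol{x})}^4=\sum_{\boldsymbol{x}\in\mathbb{F}_q^3}|g(\boldsymbol{x})|^4$; $\sigma$ is normalized counting measure on $\mathcal{S}$, so $\|f\|_{L^2(\mathcal{S},d\sigma)}^2=\frac{1}{|\mathcal{S}|}\sum_{\boldsymbol{\xi}\in\mathcal{S}}|f(\boldsymbol{\xi})|^2$. $|\cdot|$ of a set denotes cardinality. A maximizer is a nonzero function $f$ for which equality holds. *)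

(* Defs.v *)
From HB Require Import structures.
From mathcomp Require Import all_boot all_order all_algebra.
From mathcomp Require Import complex.
From mathcomp Require Import reals exp.
Set Implicit Arguments.
Unset Strict Implicit.
Unset Printing Implicit Defensive.
Import Order.TTheory GRing.Theory Num.Theory.
Local Open Scope ring_scope.
Local Open Scope complex_scope.

Section Extension.
Variables (R : realType) (F : finFieldType).

Definition nontrivial_additive_character (chi : F -> R[i]) : Prop :=
  [/\ forall x y, chi (x + y) = chi x * chi y,
      forall x, Normc.normc (chi x) = 1 &
      exists x, chi x != 1].

Definition dot (xi x : 'rV[F]_3) : F := \sum_(i < 3) xi 0 i * x 0 i.

Definition extension (chi : F -> R[i]) (S : {set 'rV[F]_3})
    (f : {xi : 'rV[F]_3 | xi \in S} -> R[i]) (x : 'rV[F]_3) : R[i] :=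
  #|S|%:R^-1 * \sum_(xi : {xi : 'rV[F]_3 | xi \in S}) f xi * chi (dot (val xi) x).

(* Counting measure on the x side, normalized counting measure on S. *)
Definition L4norm (g : 'rV[F]_3 -> R[i]) : R :=
  powR (\sum_x Normc.normc (g x) ^+ 4) 4^-1.

Definition L2norm (S : {set 'rV[F]_3})
    (f : {xi : 'rV[F]_3 | xi \in S} -> R[i]) : R :=
  Num.sqrt (#|S|%:R^-1 *
    \sum_(xi : {xi : 'rV[F]_3 | xi \in S}) Normc.normc (f xi) ^+ 2).

End Extension.

(* The coordinates xi_1, xi_2, xi_3 are those of index 0, 1, 2 in 'I_3. *)
Definition cone (F : finFieldType) : {set 'rV[F]_3} :=
  [set xi : 'rV[F]_3 | (xi 0 0 ^+ 2 == xi 0 1 * xi 0 2) && (xi != 0)].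

Definition cone_const (R : realType) (F : finFieldType) : R :=
  let q : R := #|F|%:R in
  let N : R := #|cone F|%:R in
  q ^+ 3 / N ^+ 2 * (q + 1 - (3 * q - 4) / N).

(* Main.v *)
Require Import Defs.
From HB Require Import structures.
From mathcomp Require Import all_boot all_order all_algebra all_field.
From mathcomp Require Import complex.
From mathcomp Require Import reals exp.
From mathcomp Require Import ring lra.
Set Implicit Arguments.
Unset Strict Implicit.
Unset Printing Implicit Defensive.
Import Order.TTheory GRing.Theory Num.Theory.
Local Open Scope ring_scope.
Local Open Scope complex_scope.

(* Applying Plancherel to |h|^2, where h is the Fourier transform of f, turns
   the L^4 norm into the energy E = sum over eta of |A(eta)|^2, where
   A(eta) = sum over xi of f(xi + eta) conj(f(xi)), and one may assume f >= 0.
   The number of xi such that xi and xi + eta lie on the cone is q - 2, q - 1 or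
   q + 1 when eta is on the cone, when Q(eta) = eta_1^2 - eta_2 eta_3 is a
   nonzero square, or when it is a nonsquare, so Cauchy-Schwarz bounds A(eta)^2.
   The coefficients q - 1 and q + 1 have to be balanced into q for the bound to be
   sharp.  The cone splits into two classes, according to whether the nonzero
   coordinate eta_2 or eta_3 is a square, and Q(xi - xi') is a square exactly when
   xi and xi' are in the same class.  Rewriting xi_1 - xi_3 = xi_4 - xi_2 as
   xi_1 - xi_4 = xi_3 - xi_2 then moves part of the energy of the nonsquare
   directions to the square ones.  There remains a combination of the sums of |f|^4
   and of the squared masses of |f|^2 on the q + 1 lines of the cone, which two more
   applications of Cauchy-Schwarz bound below, with equality only if |f| is
   constant. *)

(** * Squares in finite fields *)

Section Squares.
Variable F : finFieldType.
Hypothesis F2 : 2 != 0 :> F.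

Definition is_square (x : F) : bool := [exists k, k ^+ 2 == x].

(** The roots are [a + k] and [a - k], distinct because [2 != 0]. The shift [a] serves for
    quadratics after completing the square. *)
Lemma card_sqrt (a d : F) : d != 0 ->
  #|[set k | (k - a) ^+ 2 == d]| = (is_square d).*2.
Proof.
move=> d0; rewrite /is_square; case: existsP => [[k /eqP kd]|nk] /=; last first.
  apply/eqP; rewrite cards_eq0; apply/eqP/setP => x; rewrite !inE.
  by apply/negP => /eqP e; apply: nk; exists (x - a); rewrite e.
have k0 : k != 0 by apply: contraNneq d0 => k0; rewrite -kd k0 expr0n.
have -> : [set x | (x - a) ^+ 2 == d] = [set a + k; a - k].
  apply/setP => x; rewrite !inE -kd eqf_sqr.
  by congr orb; rewrite subr_eq addrC.
rewrite cards2; suff -> : a + k != a - k by [].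
by rewrite (inj_eq (addrI a)) -addr_eq0 -mulr2n -mulr_natl mulf_neq0.
Qed.

(** Squaring is two-to-one on the nonzero elements. *)
Lemma card_unit_squares : #|[set x : F | (x != 0) && is_square x]|.*2 = #|F|.-1.
Proof.
have e : #|[set~ (0 : F)]| = (\sum_(x : F | (x != 0%R) && is_square x) 2)%N.
  rewrite -sum1_card (partition_big (fun k : F => k ^+ 2)
     (fun x : F => (x != 0) && is_square x)) /=; last first.
    move=> k; rewrite !inE => k0; rewrite expf_neq0 //=.
    by apply/existsP; exists k.
  apply: eq_bigr => x /andP [x0 xs].
  transitivity #|[set k | (k - 0) ^+ 2 == x]|; last by rewrite card_sqrt // xs.
  rewrite -sum1_card.
  apply: eq_bigl => k; rewrite !inE subr0.
  apply: andb_idl => /eqP kx; apply: contraNneq x0 => k0.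
  by rewrite -kx k0 expr0n.
move: e; rewrite cardsC1 sum_nat_const => ->; rewrite muln2; congr _.*2.
by apply: eq_card => x; rewrite inE.
Qed.

Lemma exists_nonsquare : exists2 v : F, v != 0 & ~~ is_square v.
Proof.
have := card_unit_squares.
case: (pickP [pred x : F | (x != 0) && ~~ is_square x]) => [v /andP[]|h e].
  by exists v.
exfalso; move: e.
have -> : [set x : F | (x != 0) && is_square x] = [set~ 0].
  apply/setP => x; rewrite !inE; case: eqP => //= /eqP x0.
  by move: (h x); rewrite /= x0 /= => /negbFE.
have := finNzRing_gt1 F; rewrite cardsC1; case: #|F| => [|[|n]] //= _.
by rewrite -addnn -[RHS]addn0 => /addnI.
Qed.

(** Dividing by a square root settles every case but that of two nonsquares, where a count replaces
    the cyclicity of the unit group. *)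
Lemma is_squareM (a b : F) : a != 0 -> b != 0 ->
  is_square (a * b) = (is_square a == is_square b).
Proof.
have M (x y : F) : y != 0 -> is_square y -> is_square (x * y) = is_square x.
  move=> y0 /existsP[k /eqP ky]; have k0 : k != 0.
    by apply: contraNneq y0 => k0; rewrite -ky k0 expr0n.
  apply/existsP/existsP => -[z /eqP e].
    by exists (z / k); rewrite expr_div_n ky e mulfK.
  by exists (z * k); rewrite exprMn ky e.
move=> a0 b0.
have [bs|bn] := boolP (is_square b); first by rewrite M // eqb_id.
have [as_|an] := boolP (is_square a).
  by rewrite mulrC M //; apply: negbTE.
set Q := [set x : F | (x != 0) && is_square x].
set N := [set x : F | (x != 0) && ~~ is_square x].
(* Multiplication by the nonsquare [a] maps the (q-1)/2 nonzero squares into,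
   hence onto, the (q-1)/2 nonsquares. *)
have QN : (#|Q| + #|N|)%N = #|F|.-1.
  rewrite -(cardsC1 (0 : F)) -cardsUI.
  have -> : Q :&: N = set0.
    by apply/setP => x; rewrite !inE; case: (is_square x); rewrite ?andbF.
  rewrite cards0 addn0; apply: eq_card => x.
  by rewrite !inE -andb_orr orbN andbT.
have eQN : #|Q| = #|N| by have := card_unit_squares; rewrite -/Q -QN -addnn => /addnI.
have sub : [set a * x | x in Q] \subset N.
  apply/subsetP => y /imsetP[x]; rewrite !inE => /andP[x0 xs] ->.
  by rewrite mulf_neq0 //= M.
have /eqP im : [set a * x | x in Q] == N.
  by rewrite eqEcard sub card_imset ?eQN ?leqnn //; exact: (mulfI a0).
have : b \in N by rewrite inE b0 bn.
rewrite -im => /imsetP[x]; rewrite inE => /andP[x0 xs] ->.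
have -> : a * (a * x) = x * a ^+ 2 by ring.
rewrite M ?expf_neq0 //.
by apply/existsP; exists a.
Qed.

End Squares.

(** * The cone and its difference set *)

Section Cone.
Variable F : finFieldType.
Hypothesis F2 : 2 != 0 :> F.
Local Notation V := 'rV[F]_3.
Local Notation q := #|F|.

Definition qf (x : V) : F := x 0 0 ^+ 2 - x 0 1 * x 0 2.

(* The point [t (k, 1, k^2)], where the slope [None] stands for [k] infinite,
   i.e. for the line spanned by (0, 0, 1). *)
Definition cone_point (l : option F) (t : F) : V :=
  \row_i (if l is Some k then [:: k * t; t; k ^+ 2 * t] else [:: 0; 0; t])`_i.

Definition slope (x : V) : option F :=
  if x 0 1 == 0 then None else Some (x 0 0 / x 0 1).
Definition scale (x : V) : F := if x 0 1 == 0 then x 0 2 else x 0 1.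

(** Up to sign, the determinant of the representatives [(k, 1)] and [(1, 0)] of two points of the
    projective line; only its square and its vanishing matter. *)
Definition slope_diff (l m : option F) : F :=
  match l, m with
  | Some k, Some k' => k - k'
  | None, None => 0
  | _, _ => 1
  end.

Definition reps (eta : V) : nat := #|[set x in cone F | x + eta \in cone F]|.

Lemma row3P (x y : V) :
  x 0 0 = y 0 0 -> x 0 1 = y 0 1 -> x 0 2 = y 0 2 -> x = y.
Proof.
move=> e0 e1 e2; apply/rowP; case=> [[|[|[|//]]]] h.
- by rewrite (_ : Ordinal h = 0) //; apply: val_inj.
- by rewrite (_ : Ordinal h = 1) //; apply: val_inj.
- by rewrite (_ : Ordinal h = 2) //; apply: val_inj.
Qed.

Lemma coneE x : (x \in cone F) = (qf x == 0) && (x != 0).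
Proof. by rewrite inE /qf subr_eq0. Qed.

Lemma qfN x : qf (- x) = qf x.
Proof. by rewrite /qf !mxE; ring. Qed.

Lemma slope_diff_eq0 l m : (slope_diff l m == 0) = (l == m).
Proof.
case: l m => [k|] [k'|] /=; rewrite ?eqxx ?oner_eq0 ?subr_eq0 //.
Qed.

Lemma cone_point_sub l t t' :
  cone_point l t - cone_point l t' = cone_point l (t - t').
Proof. by case: l => [k|]; apply: row3P; rewrite !mxE /=; ring. Qed.

Lemma cone_point_add l t t' :
  cone_point l t + cone_point l t' = cone_point l (t + t').
Proof. by case: l => [k|]; apply: row3P; rewrite !mxE /=; ring. Qed.

Lemma qf_cone_point l t : qf (cone_point l t) = 0.
Proof. by case: l => [k|]; rewrite /qf !mxE /=; ring. Qed.

Lemma cone_point_in l t : (cone_point l t \in cone F) = (t != 0).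
Proof.
rewrite coneE qf_cone_point eqxx; congr negb; apply/eqP/eqP => [/rowP e|->].
  by case: l e => [k|] e; [have := e 1 | have := e 2]; rewrite !mxE.
by case: l => [k|]; apply: row3P; rewrite !mxE /=; ring.
Qed.

Lemma cone_pointK l t : t != 0 ->
  slope (cone_point l t) = l /\ scale (cone_point l t) = t.
Proof.
move=> t0; rewrite /slope /scale; case: l => [k|]; rewrite !mxE /= ?eqxx //.
by rewrite (negbTE t0) mulfK.
Qed.

Lemma cone_slope_scale x : x \in cone F ->
  scale x != 0 /\ cone_point (slope x) (scale x) = x.
Proof.
rewrite coneE /qf /slope /scale subr_eq0 => /andP[/eqP e x0].
have [y0|y0] := eqVneq (x 0 1) 0.
  have e0 : x 0 0 = 0.
    by move/eqP: e; rewrite y0 mul0r expf_eq0 /= => /eqP.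
  have c : cone_point None (x 0 2) = x by apply: row3P; rewrite !mxE.
  split=> //; apply: contraNneq x0 => z0; rewrite -c z0.
  by apply/eqP/row3P; rewrite !mxE.
split=> //; apply: row3P; rewrite !mxE /= ?divfK //.
by rewrite expr_div_n e; field.
Qed.

Lemma scale_neq0 x : x \in cone F -> scale x != 0.
Proof. by case/cone_slope_scale. Qed.

(** The cone is a union of [q + 1] punctured lines, with [slope] and [scale] as coordinates. *)
Lemma big_cone (T : Type) (idx : T) (op : Monoid.com_law idx) (Phi : V -> T) :
  \big[op/idx]_(x in cone F) Phi x =
  \big[op/idx]_(l : option F) \big[op/idx]_(t | t != 0) Phi (cone_point l t).
Proof.
rewrite pair_big /= (reindex_onto (fun u => cone_point u.1 u.2)
  (fun x => (slope x, scale x))) /=; last by move=> x /cone_slope_scale[].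
apply: eq_bigl => -[l t] /=; rewrite cone_point_in; case: eqVneq => //= t0.
by have [-> ->] := cone_pointK l t0; rewrite eqxx.
Qed.

Lemma card_cone_cond (P : pred V) : #|[set x in cone F | P x]| =
  (\sum_(l : option F) #|[set t | (t != 0%R) && P (cone_point l t)]|)%N.
Proof.
rewrite -sum1_card; under eq_bigl do rewrite in_set.
rewrite big_mkcondr big_cone; apply: eq_bigr => l _.
by rewrite -big_mkcondr -sum1_card; apply: eq_bigl => t; rewrite in_set.
Qed.

Lemma card_cone : #|cone F| = (q.+1 * q.-1)%N.
Proof.
have -> : cone F = [set x in cone F | xpredT x].
  by apply/setP => x; rewrite in_set andbT.
rewrite card_cone_cond -card_option -sum_nat_const; apply: eq_bigr => l _.
by rewrite -(cardsC1 (0 : F)); apply: eq_card => t; rewrite !inE andbT.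
Qed.

(** Both points are isotropic, so only the bilinear term remains. As its last factor is a square,
    the scales alone give the quadratic character of a nonzero [qf (x - y)]. *)
Lemma qf_sub x y : x \in cone F -> y \in cone F ->
  qf (x - y) = scale x * scale y * slope_diff (slope x) (slope y) ^+ 2.
Proof.
move=> /cone_slope_scale[_ {1}<-] /cone_slope_scale[_ {1}<-].
by case: (slope x) (slope y) => [k|] [k'|] /=; rewrite /qf !mxE /=; ring.
Qed.

Lemma qf_sub_eq0 x y : x \in cone F -> y \in cone F ->
  (qf (x - y) == 0) = (slope x == slope y).
Proof.
move=> hx hy; rewrite qf_sub // mulf_eq0 expf_eq0 /= slope_diff_eq0.
by rewrite mulf_eq0 !(negbTE (scale_neq0 _)).
Qed.

Lemma is_square_qf_sub x y : x \in cone F -> y \in cone F ->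
  qf (x - y) != 0 ->
  is_square (qf (x - y)) = (is_square (scale x) == is_square (scale y)).
Proof.
move=> hx hy; rewrite qf_sub_eq0 // -slope_diff_eq0 => d0.
rewrite qf_sub // is_squareM ?mulf_neq0 ?expf_neq0 ?scale_neq0 //.
rewrite (is_squareM F2) ?scale_neq0 //.
suff -> : is_square (slope_diff (slope x) (slope y) ^+ 2) by rewrite eqb_id.
by apply/existsP; exists (slope_diff (slope x) (slope y)).
Qed.

Lemma slope_sub x y : x \in cone F -> y \in cone F -> x != y ->
  slope x = slope y -> slope (x - y) = slope x.
Proof.
move=> /cone_slope_scale[_ ex] /cone_slope_scale[_ ey] xy e.
have e' : x - y = cone_point (slope x) (scale x - scale y).
  by rewrite -{1}ex -{1}ey e cone_point_sub.
have d0 : scale x - scale y != 0.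
  by apply: contra xy; rewrite subr_eq0 => /eqP s; rewrite -ex -ey e s.
by rewrite e'; have [-> _] := cone_pointK (slope x) d0.
Qed.

Lemma cone_scaler v x : v != 0 -> (v *: x \in cone F) = (x \in cone F).
Proof.
move=> v0; rewrite !coneE scaler_eq0 (negbTE v0) /=; congr andb.
have -> : qf (v *: x) = v ^+ 2 * qf x by rewrite /qf !mxE; ring.
by rewrite mulf_eq0 expf_eq0 (negbTE v0).
Qed.

(** Only the bilinear term survives, and it is linear in [y]. A nonsquare [v] thus exchanges square
    and nonsquare directions. *)
Lemma qf_sub_scale v x y : x \in cone F -> y \in cone F ->
  qf (x - v *: y) = v * qf (x - y).
Proof.
rewrite !coneE => /andP[/eqP hx _] /andP[/eqP hy _].
transitivity (v * qf (x - y) + (1 - v) * qf x + (v ^+ 2 - v) * qf y).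
  by rewrite /qf !mxE; ring.
by rewrite hx hy !mulr0 !addr0.
Qed.

(** The bilinear form attached to [qf], taken at [eta] and [cone_point l 1]. *)
Definition polar (eta : V) (l : option F) : F :=
  if l is Some k then 2 * k * eta 0 0 - eta 0 2 - k ^+ 2 * eta 0 1
  else - eta 0 1.

(** The line is isotropic, so [qf] has no [t ^+ 2] term along its translate. *)
Lemma qf_cone_point_add eta l t :
  qf (cone_point l t + eta) = qf eta + t * polar eta l.
Proof. by case: l => [k|]; rewrite /qf !mxE /=; ring. Qed.

(** As a polynomial in the slope [k], [polar eta] has discriminant [4 * qf eta]. When its leading
    coefficient [- eta 0 1] vanishes, one of the two roots moves to [None]. *)
Lemma card_polar_eq0 eta : qf eta != 0 ->
  #|[set l | polar eta l == 0]| = (is_square (qf eta)).*2.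
Proof.
move=> d0; set a := eta 0 0; set b := eta 0 1; set c := eta 0 2.
have dE : qf eta = a ^+ 2 - b * c by [].
have [b0|b0] := eqVneq b 0.
  have dE' : qf eta = a ^+ 2 by rewrite dE b0 mul0r subr0.
  have a0 : a != 0 by apply: contraNneq d0 => a0; rewrite dE' a0 expr0n.
  have -> : is_square (qf eta) by apply/existsP; exists a; rewrite dE'.
  have -> : [set l | polar eta l == 0] = [set None; Some (c / (2 * a))].
    apply/setP => -[k|]; rewrite in_set in_set2 /= -/a -/b -/c b0 ?oppr0 ?eqxx //.
    apply/eqP/eqP => [h|[->]]; last by field; rewrite a0 F2.
    congr Some; apply: (mulfI (mulf_neq0 F2 a0)).
    rewrite [RHS]mulrC divfK ?mulf_neq0 //; apply/eqP; rewrite -subr_eq0 -h.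
    by apply/eqP; ring.
  by rewrite cards2.
have -> : is_square (qf eta) = is_square (qf eta / b ^+ 2).
  rewrite is_squareM ?invr_eq0 ?expf_neq0 //.
  suff -> : is_square (b ^+ 2)^-1 by rewrite eqb_id.
  by apply/existsP; exists b^-1; rewrite exprVn.
rewrite -(card_sqrt F2 (a / b)) ?mulf_neq0 ?invr_eq0 ?expf_neq0 //.
rewrite -[RHS](card_imset _ Some_inj); apply: eq_card => l; rewrite in_set.
apply/idP/imsetP => [|[k + ->]]; last first.
  rewrite inE /= -/a -/b -/c => /eqP h; apply/eqP.
  transitivity (b * (qf eta / b ^+ 2 - (k - a / b) ^+ 2)).
    by rewrite dE; field.
  by rewrite h subrr mulr0.
case: l => [k|] /=; last by rewrite oppr_eq0 (negbTE b0).
rewrite -/a -/b -/c => /eqP h; exists k => //; rewrite inE; apply/eqP.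
transitivity (qf eta / b ^+ 2 -
  (2 * k * a - c - k ^+ 2 * b) / b); first by rewrite dE; field.
by rewrite h mul0r subr0.
Qed.

(** A line where [polar] is nonzero gives exactly one solution [t] of an affine equation; a line
    where it vanishes gives none, and [card_polar_eq0] counts these. *)
Lemma reps_nonisotropic eta : qf eta != 0 ->
  (reps eta + (is_square (qf eta)).*2)%N = q.+1.
Proof.
move=> d0; rewrite -(card_polar_eq0 d0) /reps card_cone_cond.
have -> : (\sum_l #|[set t | (t != 0%R) &&
     ((cone_point l t + eta)%R \in cone F)]|)%N = #|~: [set l | polar eta l == 0]|.
  rewrite -sum1_card [RHS]big_mkcond /=; apply: eq_bigr => l _.
  rewrite in_setC [l \in _]inE; have [p0|p0] := eqVneq (polar eta l) 0 => /=.
    apply/eqP; rewrite cards_eq0; apply/eqP/setP => t.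
    by rewrite in_set in_set0 coneE qf_cone_point_add p0 mulr0 addr0 (negbTE d0) andbF.
  transitivity #|[set - qf eta / polar eta l]|; last by rewrite cards1.
  apply: eq_card => t.
  rewrite in_set in_set1 coneE qf_cone_point_add.
  apply/idP/eqP => [/and3P[_ /eqP h _]|tE].
    by apply: (mulIf p0); rewrite divfK //; apply/eqP; rewrite -addr_eq0 addrC h.
  have h : qf eta + t * polar eta l = 0 by rewrite tE divfK ?subrr.
  rewrite h eqxx tE mulf_neq0 ?oppr_eq0 ?invr_eq0 //= -tE.
  (* A zero sum would make [eta] the opposite of an isotropic point. *)
  apply: contraNneq d0 => /eqP; rewrite addrC addr_eq0 => /eqP ->.
  by rewrite qfN qf_cone_point.
by rewrite addnC cardsC card_option.
Qed.

(** On the lines other than that of [eta], [qf] of the sum vanishes only at the excluded [t = 0]. On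
    the line of [eta], [t] has to avoid [0] and [- r]. *)
Lemma reps_cone eta : eta \in cone F -> reps eta = (q - 2)%N.
Proof.
move=> /cone_slope_scale[]; set m := slope eta; set r := scale eta => r0 e.
have pE l : polar eta l = - r * slope_diff l m ^+ 2.
  by rewrite -e; case: l m {e} => [k|] [k'|]; rewrite /polar !mxE /=; ring.
have q0 : qf eta = 0 by rewrite -e qf_cone_point.
rewrite /reps card_cone_cond (bigD1 m) //= big1 ?addn0 => [|l lm]; last first.
  have p0 : polar eta l != 0.
    by rewrite pE mulf_neq0 ?oppr_eq0 // expf_neq0 // slope_diff_eq0.
  apply/eqP; rewrite cards_eq0; apply/eqP/setP => t.
  rewrite in_set in_set0 coneE qf_cone_point_add q0 add0r mulf_eq0 (negbTE p0).
  by case: (t == 0).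
have -> : [set t | (t != 0) && (cone_point m t + eta \in cone F)] =
    ~: [set 0; - r].
  apply/setP => t; rewrite in_set in_setC in_set2 negb_or; congr andb.
  by rewrite -e cone_point_add cone_point_in addr_eq0.
by rewrite cardsCs setCK cards2 eq_sym oppr_eq0 r0.
Qed.

Lemma card_ge3 : (2 < q)%N.
Proof.
have := subset_leq_card (subsetT [set 0; 1; -1 : F]).
rewrite cardsT; apply: leq_trans; rewrite -setUA !cardsU1 cards1 in_set1 in_set2.
rewrite negb_or eq_sym oner_eq0 eq_sym oppr_eq0 oner_eq0 -addr_eq0.
by rewrite (negbTE (_ : 1 + 1 != 0)).
Qed.
End Cone.

(** * The energy inequality *)

Section CauchySchwarz.
Variables (R : realFieldType) (I : finType).

(** The variance identity, free of division; it yields both Cauchy-Schwarz and its equality case. *)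
Lemma sum_sqr_dev (P : pred I) (a : I -> R) :
  let n := #|P|%:R in let S := \sum_(i | P i) a i in
  \sum_(i | P i) (n * a i - S) ^+ 2 = n * (n * \sum_(i | P i) a i ^+ 2 - S ^+ 2).
Proof.
move=> n S.
transitivity (\sum_(i | P i) (n ^+ 2 * a i ^+ 2 - 2 * n * S * a i + S ^+ 2)).
  by apply: eq_bigr => i _; ring.
rewrite big_split sumrB -!mulr_sumr sumr_const -/S -[_ *+ #|_|]mulr_natl -/n.
by rewrite /=; ring.
Qed.

Lemma sqr_sum_le (P : pred I) (a : I -> R) :
  (\sum_(i | P i) a i) ^+ 2 <= #|P|%:R * \sum_(i | P i) a i ^+ 2.
Proof.
have [P0|P0] := posnP #|P|.
  have e i : P i = false by apply: (card0_eq P0 i).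
  by rewrite P0 mul0r !big_pred0 // expr0n.
have n0 : 0 < #|P|%:R :> R by rewrite ltr0n.
rewrite -subr_ge0 -(pmulr_rge0 _ n0) -sum_sqr_dev.
by apply: sumr_ge0 => i _; apply: sqr_ge0.
Qed.

Lemma sqr_sum_eq (P : pred I) (a : I -> R) :
  (\sum_(i | P i) a i) ^+ 2 = #|P|%:R * \sum_(i | P i) a i ^+ 2 ->
  forall i, P i -> #|P|%:R * a i = \sum_(i | P i) a i.
Proof.
move=> e i Pi; have /eqP := sum_sqr_dev P a; rewrite -e subrr mulr0.
rewrite psumr_eq0 => [/allP/(_ i)|j _]; last exact: sqr_ge0.
by rewrite mem_index_enum Pi sqrf_eq0 subr_eq0 => /(_ isT)/eqP.
Qed.

End CauchySchwarz.

(* Averaging the two bounds on [en] with weights [(q - 2) / (q - 1)] and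
   [1 / (q - 1)] makes the coefficients of [bs] and [bn] both equal to [q]. *)
Lemma energy_arith (R : realFieldType) (q X ec es en g2 bc bs bn : R) :
  3 <= q -> X = g2 + bc + bs + bn ->
  ec <= (q - 2) * bc -> es <= (q - 1) * bs -> en <= (q + 1) * bn ->
  en <= 2 * bn + es ->
  X + ec + es + en <= (q + 1) * X - 2 * (g2 + bc) - (q - 2) * g2.
Proof.
move=> q3 eX C S M M'.
have q0 : 0 <= q by apply: le_trans q3.
have q2 : 2 <= q by apply: le_trans q3; rewrite ler_nat.
have q1 : 0 < q - 1 by rewrite subr_gt0; apply: lt_le_trans q3; rewrite ltr1n.
have h : es + en <= q * (bs + bn).
  rewrite -subr_ge0 -(pmulr_rge0 _ q1).
  rewrite (_ : (q - 1) * (q * (bs + bn) - (es + en)) =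
    q * ((q - 1) * bs - es) + (q - 2) * ((q + 1) * bn - en) + (2 * bn + es - en)); last by ring.
  by apply: addr_ge0; [apply: addr_ge0; apply: mulr_ge0|]; rewrite ?subr_ge0.
(* With a common coefficient [q], [bs] and [bn] enter only through their sum, which [X]
   determines. *)
rewrite (_ : (q + 1) * X - _ - _ = X + (q - 2) * bc + q * (bs + bn)).
  by rewrite -[leLHS]addrA lerD // lerD2l.
by rewrite eX; ring.
Qed.

Section Energy.
Variables (R : realFieldType) (F : finFieldType).
Hypothesis F2 : 2 != 0 :> F.
Local Notation V := 'rV[F]_3.
Local Notation q := (#|F|%:R : R).

Definition corr (h : V -> R) (eta : V) : R := \sum_x h (x + eta) * h x.

Definition sq_dir (eta : V) := (qf eta != 0) && is_square (qf eta).
Definition nsq_dir (eta : V) := (qf eta != 0) && ~~ is_square (qf eta).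

Lemma sum_dir (X : V -> R) : \sum_eta X eta = X 0 + \sum_(eta in cone F) X eta
  + \sum_(eta | sq_dir eta) X eta + \sum_(eta | nsq_dir eta) X eta.
Proof.
rewrite (bigID (fun eta => qf eta == 0)) /= -addrA; congr (_ + _).
  have q0 : qf (0 : V) = 0 by rewrite /qf !mxE; ring.
  rewrite (bigD1 0) /= ?q0 //; congr (_ + _); apply: eq_bigl => x.
  by rewrite coneE.
by rewrite (bigID (fun eta => is_square (qf eta))).
Qed.

Lemma reps_sq_dir eta : sq_dir eta -> (reps eta)%:R = q - 1.
Proof.
move=> /andP[d0 ds]; have := reps_nonisotropic F2 d0; rewrite ds addn2 => -[<-].
by rewrite -natr1 addrK.
Qed.

Lemma reps_nsq_dir eta : nsq_dir eta -> (reps eta)%:R = q + 1.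
Proof.
move=> /andP[d0 /negbTE dn]; have := reps_nonisotropic F2 d0.
by rewrite dn addn0 => ->; rewrite -addn1 natrD.
Qed.

Lemma nsq_dirN eta : nsq_dir (- eta) = nsq_dir eta.
Proof. by rewrite /nsq_dir qfN. Qed.

Section Supported.
Variable h : V -> R.
Hypothesis h0 : forall x, x \notin cone F -> h x = 0.

Lemma sum_corr (P : pred V) : \sum_(eta | P eta) corr h eta =
  \sum_(x in cone F) \sum_(y in cone F | P (y - x)) h y * h x.
Proof.
rewrite exchange_big [RHS]big_mkcond; apply: eq_bigr => x _ /=.
case: ifPn => [xc|/h0 ->]; last by rewrite big1 // => i _; rewrite mulr0.
rewrite [RHS]big_mkcondl [RHS](reindex (fun eta => x + eta)) /=; last first.
  by exists (fun y => y - x) => y _; rewrite ?(addrC x) ?addrK ?subrK.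
apply: eq_big => [eta|eta _]; first by rewrite addrC addKr.
by case: ifPn => // /h0 ->; rewrite mul0r.
Qed.

Lemma sum_corr_all : \sum_eta corr h eta = (\sum_(x in cone F) h x) ^+ 2.
Proof.
rewrite sum_corr; under eq_bigr => x _.
  by under eq_bigl do rewrite andbT; rewrite -mulr_suml; over.
by rewrite -mulr_sumr -expr2.
Qed.

Lemma corr0 : corr h 0 = \sum_(x in cone F) h x ^+ 2.
Proof.
rewrite /corr [RHS]big_mkcond; apply: eq_bigr => x _.
by rewrite addr0; case: ifPn => // /h0 ->; rewrite mul0r.
Qed.

(** A difference of two cone points is isotropic exactly when they share a line, so the sum splits
    into squared line masses. *)
Lemma sum_corr_isotropic : corr h 0 + \sum_(eta in cone F) corr h eta =
  \sum_(l : option F) (\sum_(x in cone F | slope x == l) h x) ^+ 2.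
Proof.
transitivity (\sum_(eta | qf eta == 0) corr h eta).
  have q0 : qf (0 : V) = 0 by rewrite /qf !mxE; ring.
  rewrite [RHS](bigD1 0) /= ?q0 //; congr (_ + _); apply: eq_bigl => x.
  by rewrite coneE.
rewrite sum_corr (partition_big (@slope F) xpredT) //=; apply: eq_bigr => l _.
rewrite expr2 mulr_sumr; apply: eq_bigr => x /andP[xc /eqP xl].
rewrite -mulr_suml; congr (_ * _); apply: eq_bigl => y.
by case: (boolP (y \in cone F)) => //= yc; rewrite qf_sub_eq0 // xl.
Qed.

(** Cauchy-Schwarz over the [reps eta] terms that can be nonzero. *)
Lemma corr_sqr_le eta : corr h eta ^+ 2 <=
  (reps eta)%:R * corr (fun x => h x ^+ 2) eta.
Proof.
have e (k : V -> R) : (forall x, x \notin cone F -> k x = 0) ->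
    corr k eta = \sum_(x in [set x in cone F | x + eta \in cone F]) k (x + eta) * k x.
  move=> k0; rewrite /corr [RHS]big_mkcond; apply: eq_bigr => x _; rewrite in_set.
  case: ifPn => //; rewrite negb_and => /orP[] /k0 ->; rewrite ?mulr0 ?mul0r //.
rewrite !e // => [|x /h0 ->]; last by rewrite expr0n.
under [X in _ <= _ * X]eq_bigr do rewrite -exprMn.
exact: sqr_sum_le.
Qed.

Definition cross eta := \sum_x (if is_square (scale (x + eta)) then h (x + eta) else 0)
  * (if is_square (scale x) then 0 else h x).

(** In a nonsquare direction [x] and [x + eta] lie in different classes; the two summands correspond
    to which of them has square scale. *)
Lemma corr_cross eta : nsq_dir eta -> corr h eta = cross eta + cross (- eta).
Proof.
move=> /andP[d0 nd]; rewrite /cross [X in _ + X](reindex (fun x => x + eta)) /=.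
  rewrite -big_split; apply: eq_bigr => x _ /=; rewrite addrK.
  have [xc|/h0 ->] := boolP (x \in cone F); last first.
    by do !case: ifP; rewrite ?mulr0 ?mul0r ?addr0.
  have [yc|/h0 ->] := boolP (x + eta \in cone F); last first.
    by do !case: ifP; rewrite ?mulr0 ?mul0r ?addr0.
  have e : x + eta - x = eta by rewrite addrC addKr.
  have := is_square_qf_sub F2 yc xc; rewrite e => /(_ d0) /esym; rewrite (negbTE nd).
  case: (is_square (scale (x + eta))); case: (is_square (scale x)) => //= _.
    by rewrite mul0r addr0.
  by rewrite mul0r add0r mulrC.
by exists (fun x => x - eta) => x _; rewrite ?addrK ?subrK.
Qed.

Lemma sum_corr_cross :
  \sum_(eta | nsq_dir eta) corr h eta = 2 * \sum_(eta | nsq_dir eta) cross eta.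
Proof.
under eq_bigr => eta /corr_cross -> do [].
rewrite big_split /= mulr_natl mulr2n; congr (_ + _).
rewrite (reindex_inj oppr_inj) /=; apply: eq_big => [x|x _].
  exact: nsq_dirN.
by rewrite opprK.
Qed.
End Supported.

(** * Regrouping the energy of the nonsquare directions *)

Section Nonneg.
Variable f : V -> R.
Hypotheses (f0 : forall x, x \notin cone F -> f x = 0) (f_ge0 : forall x, 0 <= f x).
Let g x := f x ^+ 2.
Let u x := if is_square (scale x) then f x else 0.
Let v x := if is_square (scale x) then 0 else f x.

Let g0 x : x \notin cone F -> g x = 0.
Proof. by move=> /f0 gx; rewrite /g gx expr0n. Qed.
Let u_ge0 x : 0 <= u x. Proof. by rewrite /u; case: ifP. Qed.
Let v_ge0 x : 0 <= v x. Proof. by rewrite /v; case: ifP. Qed.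

(** A weighted count of parallelograms [x], [y], [y + zeta], [x + zeta]: the sides [zeta] stay
    within a class, the sides [y - x] go from one class to the other. *)
Let quads zeta := \sum_x \sum_(y | nsq_dir (y - x))
  (u y * u (y + zeta)) * (v x * v (x + zeta)).

(** Two pairs with the same difference [eta] form a parallelogram, which is indexed on the right by
    its other side [zeta]. *)
Lemma sum_cross_sqr :
  \sum_(eta | nsq_dir eta) cross f eta ^+ 2 = \sum_zeta quads zeta.
Proof.
rewrite /quads exchange_big /=.
under [RHS]eq_bigr do rewrite exchange_big /=.
under [LHS]eq_bigr do rewrite expr2 mulr_suml.
rewrite exchange_big /=; apply: eq_bigr => x _.
rewrite [RHS](reindex (fun eta => x + eta)) /=; last first.
  by exists (fun y => y - x) => y _; rewrite ?(addrC x) ?addrK ?subrK.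
apply: eq_big => [eta|eta _]; first by rewrite addrC addKr.
rewrite mulr_sumr (reindex (fun zeta => x + zeta)) /=; last first.
  by exists (fun y => y - x) => y _; rewrite ?(addrC x) ?addrK ?subrK.
apply: eq_bigr => zeta _; rewrite -/(u _) -/(u _) -/(v _) -/(v _).
by rewrite (addrAC x zeta) mulrACA.
Qed.

Lemma quads0 : quads 0 = \sum_(eta | nsq_dir eta) cross g eta.
Proof.
rewrite /quads [RHS]exchange_big /=; apply: eq_bigr => x _.
rewrite [LHS](reindex (fun eta => x + eta)) /=; last first.
  by exists (fun y => y - x) => y _; rewrite ?(addrC x) ?addrK ?subrK.
apply: eq_big => [eta|eta _]; first by rewrite addrC addKr.
rewrite !addr0 /u /v /g.
by do 2!case: ifP => _; rewrite ?mulr0 ?mul0r.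
Qed.

(** Forgetting the condition on [y - x] bounds [quads zeta] by the product of the correlations
    inside each class. The inequality [4ab <= (a + b)^2] concludes, since [f >= 0] lets the mixed
    pairs be dropped from [corr f zeta]. *)
Lemma quads_sq zeta : sq_dir zeta -> 4 * quads zeta <= corr f zeta ^+ 2.
Proof.
move=> _; pose uu := \sum_x u x * u (x + zeta); pose vv := \sum_x v x * v (x + zeta).
have uu_ge0 : 0 <= uu by apply: sumr_ge0 => x _; apply: mulr_ge0.
have vv_ge0 : 0 <= vv by apply: sumr_ge0 => x _; apply: mulr_ge0.
have le1 : quads zeta <= uu * vv.
  rewrite /quads mulrC mulr_suml; apply: ler_sum => x _.
  rewrite -mulr_suml [leRHS]mulrC; apply: ler_wpM2r; first exact: mulr_ge0.
  rewrite /uu [leRHS](bigID (fun y => nsq_dir (y - x))) /= lerDl.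
  by apply: sumr_ge0 => y _; apply: mulr_ge0.
have le2 : uu + vv <= corr f zeta.
  rewrite -big_split; apply: ler_sum => x _ /=; rewrite /u /v.
  have := mulr_ge0 (f_ge0 (x + zeta)) (f_ge0 x).
  by do 2!case: ifP => _; rewrite ?mulr0 ?mul0r ?addr0 ?add0r // mulrC.
have : (uu + vv) ^+ 2 <= corr f zeta ^+ 2.
  by rewrite ler_pXn2r // nnegrE; [exact: addr_ge0|exact: le_trans (addr_ge0 _ _) le2].
apply: le_trans; have := sqr_ge0 (uu - vv); lra.
Qed.

(* If [y - x = (y + zeta) - (x + zeta)] with [y], [y + zeta] in one class and
   [x], [x + zeta] in the other, then [zeta] is a square direction: in an
   isotropic direction all four points would lie on one line. *)
Lemma quads_other zeta : zeta != 0 -> ~~ sq_dir zeta -> quads zeta = 0.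
Proof.
move=> z0 nz; rewrite /quads big1 // => x _; rewrite big1 // => y /andP[d0 nd].
apply/eqP; apply: contraNT nz; rewrite /u /v.
have [yc|/f0 ->] := boolP (y \in cone F); last by rewrite if_same !mul0r eqxx.
have [yzc|/f0 ->] := boolP (y + zeta \in cone F); last first.
  by rewrite if_same mulr0 mul0r eqxx.
have [xc|/f0 ->] := boolP (x \in cone F); last by rewrite if_same mul0r mulr0 eqxx.
have [xzc|/f0 ->] := boolP (x + zeta \in cone F); last by rewrite if_same !mulr0 eqxx.
case: ifP => ys; last by rewrite !mul0r eqxx.
case: ifP => yzs; last by rewrite mulr0 mul0r eqxx.
case: ifP => xs; first by rewrite mul0r mulr0 eqxx.
move=> _; have yz : y + zeta - y = zeta by rewrite addrC addKr.
have xz : x + zeta - x = zeta by rewrite addrC addKr.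
have [zq|zq] := eqVneq (qf zeta) 0; last first.
  by rewrite /sq_dir zq -yz is_square_qf_sub ?yz // ys yzs.
have sub_slope w : w \in cone F -> w + zeta \in cone F -> slope w = slope zeta.
  move=> wc wzc; have wz : w + zeta - w = zeta by rewrite addrC addKr.
  have e : slope (w + zeta) = slope w.
    by apply/eqP; rewrite -qf_sub_eq0 // wz zq.
  by rewrite -e -[in RHS]wz slope_sub // -subr_eq0 wz.
by move: d0; rewrite qf_sub_eq0 // !sub_slope // eqxx.
Qed.

(** By [(a + b)^2 <= 2a^2 + 2b^2] and the symmetry in [eta], the left side is at most four times the
    energy of [cross f]. After regrouping, [zeta = 0] gives the first term and the square directions
    give the second. *)
Lemma nsq_energy_le : \sum_(eta | nsq_dir eta) corr f eta ^+ 2 <=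
  2 * \sum_(eta | nsq_dir eta) corr g eta + \sum_(eta | sq_dir eta) corr f eta ^+ 2.
Proof.
apply: (@le_trans _ _ (4 * \sum_(eta | nsq_dir eta) cross f eta ^+ 2)).
  apply: (@le_trans _ _ (2 * \sum_(eta | nsq_dir eta) cross f eta ^+ 2 +
      2 * \sum_(eta | nsq_dir eta) cross f (- eta) ^+ 2)).
    rewrite !mulr_sumr -big_split; apply: ler_sum => eta /(corr_cross f0) -> /=.
    have := sqr_ge0 (cross f eta - cross f (- eta)); lra.
  have -> : \sum_(eta | nsq_dir eta) cross f (- eta) ^+ 2 =
      \sum_(eta | nsq_dir eta) cross f eta ^+ 2.
    rewrite (reindex_inj oppr_inj) /=; apply: eq_big => [x|x _].
      exact: nsq_dirN.
    by rewrite opprK.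
  lra.
rewrite sum_cross_sqr (bigD1 0) //= mulrDr quads0 (sum_corr_cross g0).
apply: lerD; first lra.
rewrite mulr_sumr (bigID sq_dir) /= [X in _ + X]big1 => [|z /andP[z0 nz]]; last first.
  by rewrite quads_other // mulr0.
rewrite addr0 [leLHS](eq_bigl sq_dir) => [|z]; first exact: ler_sum quads_sq.
have [->|//] := eqVneq z 0.
by rewrite /sq_dir /qf !mxE mul0r expr0n subr0 eqxx.
Qed.

Lemma energy_le : \sum_eta corr f eta ^+ 2 <=
  (q + 1) * (\sum_(x in cone F) g x) ^+ 2
  - 2 * \sum_(l : option F) (\sum_(x in cone F | slope x == l) g x) ^+ 2
  - (q - 2) * \sum_(x in cone F) g x ^+ 2.
Proof.
have q3 : 3 <= q by rewrite ler_nat (card_ge3 F2).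
have E := sum_dir (fun eta => corr f eta ^+ 2).
have := sum_dir (corr g); rewrite (sum_corr_all g0) => B.
have L := sum_corr_isotropic g0.
have Q := corr0 g0.
have Z := corr0 f0.
have C : \sum_(eta in cone F) corr f eta ^+ 2 <=
    (q - 2) * \sum_(eta in cone F) corr g eta.
  rewrite mulr_sumr; apply: ler_sum => eta ec.
  apply: le_trans (corr_sqr_le f0 eta) _.
  by rewrite (reps_cone ec) natrB // ltnW // (card_ge3 F2).
have S : \sum_(eta | sq_dir eta) corr f eta ^+ 2 <=
    (q - 1) * \sum_(eta | sq_dir eta) corr g eta.
  rewrite mulr_sumr; apply: ler_sum => eta /andP[d0 ds].
  apply: le_trans (corr_sqr_le f0 eta) _.
  by rewrite reps_sq_dir //; apply/andP.
have M : \sum_(eta | nsq_dir eta) corr f eta ^+ 2 <=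
    (q + 1) * \sum_(eta | nsq_dir eta) corr g eta.
  rewrite mulr_sumr; apply: ler_sum => eta /andP[d0 ds].
  apply: le_trans (corr_sqr_le f0 eta) _.
  by rewrite reps_nsq_dir //; apply/andP.
have M' := nsq_energy_le.
(* The bare [X] of [energy_arith] is [corr f 0 ^+ 2], the squared total mass of [g]. *)
rewrite -/g in B L Q *; rewrite E Z -L -Q.
by apply: energy_arith (C) (S) (M) (M'); [exact: q3 | exact: B].
Qed.

End Nonneg.
End Energy.

(** * The sharp constant and the equality case *)

Section Sharp.
Variables (R : realFieldType) (F : finFieldType).
Hypothesis F2 : 2 != 0 :> F.
Local Notation V := 'rV[F]_3.
Local Notation q := (#|F|%:R : R).
Local Notation N := (#|cone F|%:R : R).

Definition energy_const : R := q + 1 - (3 * q - 4) / N.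

Let q3 : 3 <= q. Proof. by rewrite ler_nat (card_ge3 F2). Qed.
Let q2 : 0 < q - 2.
Proof. by rewrite subr_gt0; apply: lt_le_trans q3; rewrite ltr_nat. Qed.
Let q1 : 0 < q - 1. Proof. by rewrite subr_gt0; apply: lt_le_trans q3; rewrite ltr1n. Qed.
Let q0 : 0 < q + 1. Proof. by rewrite natr1 ltr0n. Qed.

Lemma card_coneR : N = (q + 1) * (q - 1).
Proof.
rewrite card_cone natrM -natr1; congr (_ * _).
by rewrite -subn1 natrB // ltnW // finNzRing_gt1.
Qed.

Lemma card_cone_gt0 : 0 < N.
Proof. by rewrite card_coneR mulr_gt0. Qed.

Section Function.
Variable f : V -> R.
Hypotheses (f0 : forall x, x \notin cone F -> f x = 0) (f_ge0 : forall x, 0 <= f x).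
Let G := \sum_(x in cone F) f x ^+ 2.

(** Cauchy-Schwarz over the [q + 1] lines bounds the line masses. The second application, over the
    cone, is left as an explicit variance of [f ^+ 2], from which the equality case is read. *)
Lemma energy_le_variance : \sum_eta corr f eta ^+ 2 +
  (q - 2) * (\sum_(x in cone F) (f x ^+ 2) ^+ 2 - G ^+ 2 / N) <= energy_const * G ^+ 2.
Proof.
apply: le_trans (lerD (energy_le F2 f0 f_ge0) (lexx _)) _; rewrite -/G.
set L := \sum_l _; set g2 := \sum_(x in _) _.
have hL : G ^+ 2 <= (q + 1) * L.
  have -> : G = \sum_(l : option F) \sum_(x in cone F | slope x == l) f x ^+ 2.
    by rewrite /G (partition_big (@slope F) xpredT).
  have := sqr_sum_le xpredT
    (fun l : option F => \sum_(x in cone F | slope x == l) f x ^+ 2).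
  by rewrite card_option natr1.
rewrite -subr_ge0.
(* Here [3q - 4] appears: [2 / (q + 1) + (q - 2) / N = (3q - 4) / N] because
   [N = (q + 1)(q - 1)]. *)
have -> : energy_const * G ^+ 2 - ((q + 1) * G ^+ 2 - 2 * L - (q - 2) * g2
   + (q - 2) * (g2 - G ^+ 2 / N)) = 2 / (q + 1) * ((q + 1) * L - G ^+ 2).
  rewrite /energy_const card_coneR; field.
  by rewrite !gt_eqF.
by rewrite mulr_ge0 ?subr_ge0 // divr_ge0 // ltW.
Qed.

Lemma sharp_energy_le : \sum_eta corr f eta ^+ 2 <= energy_const * G ^+ 2.
Proof.
apply: le_trans energy_le_variance; rewrite lerDl mulr_ge0 ?(ltW q2) //.
rewrite subr_ge0 ler_pdivrMr ?card_cone_gt0 // mulrC.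
exact: sqr_sum_le.
Qed.

(** Since [q - 2 > 0], equality forces the variance to vanish. *)
Lemma sharp_energy_eq : \sum_eta corr f eta ^+ 2 = energy_const * G ^+ 2 ->
  forall x, x \in cone F -> N * f x ^+ 2 = G.
Proof.
move=> e; apply: (@sqr_sum_eq R _ (mem (cone F)) (fun x => f x ^+ 2)).
apply/eqP; rewrite eq_le sqr_sum_le /=.
have := energy_le_variance; rewrite e gerDl pmulr_rle0 // subr_le0.
by rewrite ler_pdivlMr ?card_cone_gt0 // mulrC.
Qed.
End Function.

(** Dilating one of the two points by a nonsquare preserves the cone and exchanges the two kinds of
    directions. *)
Lemma sum_corr_sq_nsq (h : V -> R) :
  (forall x, h x = (x \in cone F)%:R) ->
  \sum_(eta | sq_dir eta) corr h eta = \sum_(eta | nsq_dir eta) corr h eta.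
Proof.
move=> hE; have h0 x : x \notin cone F -> h x = 0 by rewrite hE => /negbTE ->.
have [v v0 nv] := exists_nonsquare F2.
rewrite !sum_corr //; apply: eq_bigr => x xc.
rewrite [RHS](reindex_inj (can_inj (scalerK v0))) /=.
apply: eq_big => [y|y /andP[yc _]]; last by rewrite !hE cone_scaler // yc.
rewrite cone_scaler //; have [yc|//] := boolP (y \in cone F) => /=.
rewrite /sq_dir /nsq_dir -(qfN (y - x)) -(qfN (v *: y - x)) !opprB.
rewrite qf_sub_scale // mulf_eq0 (negbTE v0) /=.
have [//|d0] := eqVneq (qf (x - y)) 0.
by rewrite is_squareM // (negbTE nv); case: is_square.
Qed.

(** No count of the directions is needed: the square and nonsquare ones carry the same mass [b], and
    the total mass gives [N^2 = N + (q - 2) N + 2b]. *)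
Lemma energy_cone : \sum_(eta : V)
  corr (fun x => (x \in cone F)%:R : R) eta ^+ 2 = energy_const * N ^+ 2.
Proof.
set h : V -> R := fun x => (x \in cone F)%:R.
have h0 x : x \notin cone F -> h x = 0 by rewrite /h => /negbTE ->.
have corrE eta : corr h eta = (reps eta)%:R.
  rewrite /corr /reps -sum1_card natr_sum [RHS]big_mkcond; apply: eq_bigr => x _.
  by rewrite /h in_set; do 2!case: (_ \in cone F); rewrite ?mulr1 ?mulr0.
have sumh : \sum_(x in cone F) h x = N.
  by rewrite -sum1_card natr_sum; apply: eq_bigr => x xc; rewrite /h xc.
have c0 : corr h 0 = N.
  by rewrite corr0 // -sumh; apply: eq_bigr => x xc; rewrite /h xc expr1n.
have := sum_dir (corr h); rewrite sum_corr_all // sumh c0.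
rewrite (sum_corr_sq_nsq (h := h)) // sum_dir c0.
have -> : \sum_(eta in cone F) corr h eta = (q - 2) * N.
  rewrite -sumh mulr_sumr; apply: eq_bigr => eta ec.
  rewrite corrE (reps_cone ec) natrB ?(ltnW (card_ge3 F2)) //.
  by rewrite /h ec mulr1.
have -> : \sum_(eta in cone F) corr h eta ^+ 2 = (q - 2) ^+ 2 * N.
  rewrite -sumh mulr_sumr; apply: eq_bigr => eta ec.
  rewrite corrE (reps_cone ec) natrB ?(ltnW (card_ge3 F2)) //.
  by rewrite /h ec mulr1.
have -> : \sum_(eta | sq_dir eta) corr h eta ^+ 2 =
    (q - 1) * \sum_(eta | nsq_dir eta) corr h eta.
  rewrite -(sum_corr_sq_nsq (h := h)) // mulr_sumr; apply: eq_bigr => eta ed.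
  by rewrite corrE (reps_sq_dir R F2 ed) expr2.
have -> : \sum_(eta | nsq_dir eta) corr h eta ^+ 2 =
    (q + 1) * \sum_(eta | nsq_dir eta) corr h eta.
  rewrite mulr_sumr; apply: eq_bigr => eta ed.
  by rewrite corrE (reps_nsq_dir R F2 ed) expr2.
set b := \sum_(eta | nsq_dir eta) _ => e.
have -> : energy_const * N ^+ 2 = q * N ^+ 2 + N ^+ 2 - (3 * q - 4) * N.
  by rewrite /energy_const; field; rewrite gt_eqF // card_cone_gt0.
by rewrite {2}e; ring.
Qed.

End Sharp.

(** * Fourier analysis *)

Section Fourier.
Variables (C : numClosedFieldType) (F : finFieldType) (chi : F -> C).
Hypotheses (chiD : forall x y, chi (x + y) = chi x * chi y)
  (chi1 : forall x, `|chi x| = 1) (chi_nt : exists x, chi x != 1).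
Local Notation V := 'rV[F]_3.
Local Notation conj := Num.conj.

Definition fourier (h : V -> C) (x : V) : C := \sum_xi h xi * chi (dot xi x).
Definition autocorr (h : V -> C) (eta : V) : C := \sum_xi h (xi + eta) * conj (h xi).

Let chi_neq0 x : chi x != 0. Proof. by rewrite -normr_eq0 chi1 oner_eq0. Qed.

Lemma character0 : chi 0 = 1.
Proof. by apply: (mulfI (chi_neq0 0)); rewrite -chiD addr0 mulr1. Qed.

Lemma characterN x : chi (- x) = conj (chi x).
Proof.
by apply: (mulfI (chi_neq0 x)); rewrite -chiD subrr character0 -normCK chi1 expr1n.
Qed.

Lemma dotBl (x y z : V) : dot (x - y) z = dot x z - dot y z.
Proof. by rewrite /dot -sumrB; apply: eq_bigr => i _; rewrite !mxE mulrBl. Qed.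

Lemma dotDr (x y z : V) : dot x (y + z) = dot x y + dot x z.
Proof. by rewrite /dot -big_split; apply: eq_bigr => i _; rewrite !mxE mulrDr. Qed.

(** For [eta != 0], a translation by some [y] with [chi (dot eta y) != 1] multiplies the sum by that
    value, so the sum vanishes. *)
Lemma character_sum (eta : V) :
  \sum_x chi (dot eta x) = (eta == 0)%:R * #|F|%:R ^+ 3.
Proof.
have [->|e0] := eqVneq eta 0.
  rewrite mul1r (eq_bigr (fun => 1)) => [|x _]; last first.
    by rewrite /dot big1 ?character0 // => i _; rewrite mxE mul0r.
  by rewrite sumr_const card_mx mul1n natrX.
rewrite mul0r; have [t ct] := chi_nt.
have [i ei] : exists i, eta 0 i != 0.
  apply/existsP; apply: contraNT e0 => /existsPn e; apply/eqP/rowP => i.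
  by rewrite mxE; apply/eqP; have := e i; rewrite negbK.
pose y : V := t / eta 0 i *: delta_mx 0 i.
have dy : dot eta y = t.
  rewrite /dot (bigD1 i) //= big1 => [|j ji]; last first.
    by rewrite !mxE (negbTE ji) andbF !mulr0.
  by rewrite !mxE !eqxx mulr1 addr0 mulrC divfK.
set S := \sum_x _; have : chi t * S = S.
  rewrite mulr_sumr /S [RHS](reindex_inj (addrI y)) /=.
  by apply: eq_bigr => x _; rewrite dotDr dy chiD.
move/eqP; rewrite -subr_eq0 -{2}[S]mul1r -mulrBl mulf_eq0 subr_eq0 (negbTE ct).
by move/eqP.
Qed.

Lemma plancherel (h : V -> C) :
  \sum_x `|fourier h x| ^+ 2 = #|F|%:R ^+ 3 * \sum_xi `|h xi| ^+ 2.
Proof.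
transitivity (\sum_xi \sum_zeta h xi * conj (h zeta) *
    \sum_x chi (dot (xi - zeta) x)).
  under eq_bigr => x _.
    rewrite normCK /fourier rmorph_sum mulr_suml.
    by under eq_bigr do rewrite mulr_sumr; over.
  rewrite exchange_big /=; apply: eq_bigr => xi _.
  rewrite exchange_big /=; apply: eq_bigr => zeta _; rewrite mulr_sumr.
  apply: eq_bigr => x _.
  by rewrite dotBl chiD characterN rmorphM mulrACA.
rewrite mulr_sumr; apply: eq_bigr => xi _.
rewrite (bigD1 xi) //= [X in _ + X]big1 => [|zeta zx]; last first.
  by rewrite character_sum subr_eq0 eq_sym (negbTE zx) mul0r mulr0.
by rewrite character_sum subrr eqxx mul1r addr0 -normCK mulrC.
Qed.

(** The Wiener-Khinchin identity: the product is expanded and grouped by differences of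
    frequencies. *)
Lemma sqr_norm_fourier (h : V -> C) x : `|fourier h x| ^+ 2 = fourier (autocorr h) x.
Proof.
rewrite normCK /fourier rmorph_sum mulrC mulr_suml.
under eq_bigr do rewrite mulr_sumr.
under [RHS]eq_bigr do rewrite /autocorr mulr_suml.
rewrite [RHS]exchange_big /=; apply: eq_bigr => xi _.
rewrite (reindex_inj (addrI xi)) /=; apply: eq_bigr => eta _.
have -> : chi (dot eta x) = conj (chi (dot xi x)) * chi (dot (xi + eta) x).
  rewrite -characterN -chiD; congr chi; rewrite -{1}[eta](addKr xi) addrC.
  by rewrite dotBl addrC.
by rewrite rmorphM /=; ring.
Qed.

Lemma fourier_L4 (h : V -> C) :
  \sum_x `|fourier h x| ^+ 4 = #|F|%:R ^+ 3 * \sum_eta `|autocorr h eta| ^+ 2.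
Proof.
rewrite -plancherel; apply: eq_bigr => x _.
by rewrite -sqr_norm_fourier normrX normr_id -exprM.
Qed.
End Fourier.

(** * The extension inequality on the cone *)

Section ConeExtension.
Variables (R : realType) (F : finFieldType) (chi : F -> R[i]).
Hypothesis F2 : 2 != 0 :> F.
Hypothesis hchi : nontrivial_additive_character chi.
Local Notation V := 'rV[F]_3.
Local Notation q := (#|F|%:R : R).
Local Notation N := (#|cone F|%:R : R).
Local Notation normc := Normc.normc.
Local Notation S := {xi : V | xi \in cone F}.

(** Extending by zero to the whole group gives a meaning to the translates in [autocorr]. *)
Definition zero_ext (f : S -> R[i]) (x : V) : R[i] :=
  if insub x is Some u then f u else 0.

Lemma zero_ext_val f u : zero_ext f (val u) = f u.
Proof. by rewrite /zero_ext valK. Qed.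

Lemma zero_ext0 f x : x \notin cone F -> zero_ext f x = 0.
Proof. by move=> xc; rewrite /zero_ext insubN. Qed.

Lemma normrE_normc (z : R[i]) : `|z| = (normc z)%:C.
Proof. by []. Qed.

Lemma normc_ge0 (z : R[i]) : 0 <= normc z.
Proof. by rewrite -lecR -normrE_normc normr_ge0. Qed.

Lemma extensionE f x :
  extension chi f x = #|cone F|%:R^-1 * fourier chi (zero_ext f) x.
Proof.
congr (_ * _); rewrite /fourier (bigID (fun x => x \in cone F)) /= [X in _ + X]big1.
  by rewrite addr0 [RHS]big_sub; apply: eq_bigr => u _; rewrite zero_ext_val.
by move=> y /zero_ext0 ->; rewrite mul0r.
Qed.

Lemma L4norm_extension f : L4norm (extension chi f) ^+ 4 =
  q ^+ 3 / N ^+ 4 * \sum_eta normc (autocorr (zero_ext f) eta) ^+ 2.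
Proof.
have [chiD chi1 chi_nt] := hchi.
rewrite /L4norm -powR_mulrn ?powR_ge0 // -powRrM mulVf ?pnatr_eq0 //.
rewrite powRr1; last by apply: sumr_ge0 => x _; rewrite exprn_ge0 ?normc_ge0.
(* The identity is moved to [R[i]], where [fourier_L4] applies. *)
apply: complexI; rewrite rmorphM fmorph_div !rmorphXn !rmorph_nat !rmorph_sum /=.
transitivity (\sum_x (#|cone F|%:R ^- 4 * `|fourier chi (zero_ext f) x| ^+ 4)).
  apply: eq_bigr => x _; rewrite rmorphXn /= -normrE_normc extensionE.
  by rewrite normrM exprMn normfV normr_nat exprVn.
rewrite -mulr_sumr fourier_L4 // => [|x]; last by rewrite normrE_normc chi1.
rewrite mulrA [_^-1 * _]mulrC; congr (_ * _); apply: eq_bigr => eta _.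
by rewrite rmorphXn.
Qed.

Lemma L2norm_pow4 (f : S -> R[i]) : L2norm f ^+ 4 =
  (\sum_(x in cone F) normc (zero_ext f x) ^+ 2) ^+ 2 / N ^+ 2.
Proof.
rewrite /L2norm (exprM _ 2 2) sqr_sqrtr; last first.
  by apply: mulr_ge0; rewrite ?invr_ge0 ?ler0n //; apply: sumr_ge0 => x _; apply: sqr_ge0.
rewrite exprMn exprVn mulrC [in RHS]big_sub; congr (_ ^+ 2 / _).
by apply: eq_bigr => u _; rewrite zero_ext_val.
Qed.

(** The triangle inequality; it reduces the problem to nonnegative functions, as the right-hand side
    of the theorem sees only [|f|]. *)
Lemma normc_autocorr_le (h : V -> R[i]) eta :
  normc (autocorr h eta) <= corr (fun x => normc (h x)) eta.
Proof.
rewrite -lecR -normrE_normc /corr rmorph_sum.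
apply: le_trans (ler_norm_sum _ _ _) _; apply: ler_sum => x _.
by rewrite normrM norm_conjC !normrE_normc rmorphM.
Qed.

(** Brings out the factor of [L4norm_extension], so that only energies remain to be compared. *)
Lemma cone_const_L2 (f : S -> R[i]) : cone_const R F * L2norm f ^+ 4 = q ^+ 3 / N ^+ 4 *
  (energy_const R F * (\sum_(x in cone F) normc (zero_ext f x) ^+ 2) ^+ 2).
Proof.
rewrite L2norm_pow4 /cone_const /energy_const; field.
by rewrite gt_eqF // card_cone_gt0.
Qed.

Lemma energy_autocorr_le f : \sum_eta normc (autocorr (zero_ext f) eta) ^+ 2 <=
  \sum_eta corr (fun x => normc (zero_ext f x)) eta ^+ 2.
Proof.
apply: ler_sum => eta _; rewrite ler_pXn2r ?nnegrE ?normc_ge0 //.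
  exact: normc_autocorr_le.
exact: le_trans (normc_ge0 _) (normc_autocorr_le _ _).
Qed.

Let c_gt0 : 0 < q ^+ 3 / N ^+ 4.
Proof.
by rewrite divr_gt0 ?exprn_gt0 ?card_cone_gt0 // ltr0n (leq_trans _ (card_ge3 F2)).
Qed.

Let normc_zero_ext0 f x : x \notin cone F -> normc (zero_ext f x) = 0.
Proof. by move=> /zero_ext0 ->; rewrite Normc.normc0. Qed.

Lemma cone_extension_le (f : S -> R[i]) :
  L4norm (extension chi f) ^+ 4 <= cone_const R F * L2norm f ^+ 4.
Proof.
rewrite L4norm_extension cone_const_L2 ler_pM2l //.
apply: le_trans (energy_autocorr_le f) _.
by apply: sharp_energy_le => // [x|x]; [exact: normc_zero_ext0|exact: normc_ge0].
Qed.

(** Both sides scale by [|c|^4], which leaves the indicator of the cone. *)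
Lemma cone_extension_const c : let f := fun _ : S => c in
  L4norm (extension chi f) ^+ 4 = cone_const R F * L2norm f ^+ 4.
Proof.
move=> f; rewrite L4norm_extension cone_const_L2; congr (_ * _).
have hE x : zero_ext f x = c * ((x \in cone F)%:R : R)%:C.
  have [xc|xc] := boolP (x \in cone F); last by rewrite zero_ext0 // mulr0.
  by rewrite -[x]/(val (exist _ x xc : S)) zero_ext_val mulr1.
have -> : \sum_(x in cone F) normc (zero_ext f x) ^+ 2 = normc c ^+ 2 * N.
  rewrite mulr_natr -sumr_const; apply: eq_bigr => x xc.
  by rewrite hE xc mulr1.
rewrite exprMn mulrCA -energy_cone // mulr_sumr; apply: eq_bigr => eta _.
rewrite -exprMn; congr (_ ^+ 2); apply: complexI.
rewrite -normrE_normc rmorphM rmorphXn /= -normrE_normc.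
have -> : autocorr (zero_ext f) eta =
    `|c| ^+ 2 * (corr (fun x => (x \in cone F)%:R : R) eta)%:C.
  rewrite /corr rmorph_sum mulr_sumr; apply: eq_bigr => x _.
  by rewrite !hE normCK !rmorphM /= !rmorph_nat; ring.
rewrite normrM normrX normr_id ger0_norm // lecR.
by apply: sumr_ge0 => x _; rewrite -natrM ler0n.
Qed.

Lemma cone_extension_maximizer (f : S -> R[i]) :
  L4norm (extension chi f) ^+ 4 = cone_const R F * L2norm f ^+ 4 ->
  exists r : R, forall xi, normc (f xi) = r.
Proof.
rewrite L4norm_extension cone_const_L2 => /(mulfI (lt0r_neq0 c_gt0)) e.
pose g x := normc (zero_ext f x).
have g0 x : x \notin cone F -> g x = 0 by apply: normc_zero_ext0.
have g_ge0 x : 0 <= g x by apply: normc_ge0.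
(* Equality for [f] squeezes the energy of [|f|] between that of [f] and the sharp bound. *)
have eq : \sum_eta corr g eta ^+ 2 =
    energy_const R F * (\sum_(x in cone F) g x ^+ 2) ^+ 2.
  by apply/eqP; rewrite eq_le sharp_energy_le //= -e energy_autocorr_le.
(* The constant modulus has to be the quadratic mean of [|f|]. *)
exists (Num.sqrt ((\sum_(x in cone F) g x ^+ 2) / N)) => xi.
rewrite -(sharp_energy_eq F2 g0 g_ge0 eq (valP xi)) mulrAC divff; last first.
  by rewrite gt_eqF // card_cone_gt0.
by rewrite mul1r sqrtr_sqr ger0_norm // /g zero_ext_val.
Qed.

(** The function [1] attains equality and has positive [L2norm]. *)
Lemma cone_const_le (K : R) :
  (forall f : S -> R[i],
     L4norm (extension chi f) ^+ 4 <= K * L2norm f ^+ 4) ->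
  cone_const R F <= K.
Proof.
move=> /(_ (fun=> 1)); rewrite cone_extension_const ler_pM2r //.
rewrite L2norm_pow4 divr_gt0 ?exprn_gt0 ?card_cone_gt0 //.
rewrite (eq_bigr (fun => 1)) => [|x xc].
  by rewrite sumr_const card_cone_gt0.
by rewrite -[x]/(val (exist _ x xc : S)) zero_ext_val Normc.normc1 expr1n.
Qed.
End ConeExtension.

Theorem corollary1p5 (R : realType) (F : finFieldType) (p : nat)
    (hp : p \in [pchar F]) (podd : odd p)
    (chi : F -> R[i]) (hchi : nontrivial_additive_character chi) :
  [/\ forall f : {xi : 'rV[F]_3 | xi \in cone F} -> R[i],
        L4norm (extension chi f) ^+ 4 <= cone_const R F * L2norm f ^+ 4,
      forall K : R,
        (forall f : {xi : 'rV[F]_3 | xi \in cone F} -> R[i],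
           L4norm (extension chi f) ^+ 4 <= K * L2norm f ^+ 4) ->
        cone_const R F <= K,
      forall c : R[i],
        let f := fun _ : {xi : 'rV[F]_3 | xi \in cone F} => c in
        L4norm (extension chi f) ^+ 4 = cone_const R F * L2norm f ^+ 4 &
      forall f : {xi : 'rV[F]_3 | xi \in cone F} -> R[i],
        (exists xi, f xi != 0) ->
        L4norm (extension chi f) ^+ 4 = cone_const R F * L2norm f ^+ 4 ->
        exists r : R, forall xi, Normc.normc (f xi) = r].
Proof.
have F2 : 2 != 0 :> F.
  (* In characteristic [p], [2 = 0] would mean that [p] divides 2, impossible for an odd prime. *)
  rewrite -(dvdn_pcharf hp); apply: contraL podd => /dvdn_leq -/(_ isT) p2.
  by case: p hp p2 => [|[|[|p]]] // /pcharf_prime.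
split.
- exact: cone_extension_le.
- by move=> K; apply: cone_const_le.
- exact: cone_extension_const.
- by move=> f _; apply: cone_extension_maximizer.
Qed.
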